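(* Let $k \ge 1$ be an integer and let $$M(k) = \mathrm{rad}\left(\prod_{i=1}^{k}\left(2^{i/\gcd(i,k)}-(-1)^{k/\gcd(i,k)}\right)\right).$$ Then, for odd primes $p$, the value of $n(p^k,2)$ only depends on the class of $p$ modulo $M(k)$; that is, if $p$ and $p'$ are odd primes with $p \equiv p' \pmod{M(k)}$, then $n(p^k,2)=n(p'^k,2)$.
   Context: $\mathbb{N}=\{0,1,2,\dots\}$. A numerical semigroup is a subset $S\subset\mathbb{N}$ containing $0$, stable under addition and with finite complement in $\mathbb{N}$; its genus is $|\mathbb{N}\setminus S|$. For $g\ge 1$, $n(g,2)$ denotes the number of numerical semigroups $S$ of genus $g$ of the form $S=\langle a,b\rangle=\mathbb{N}a+\mathbb{N}b$ (two generators); semigroups are counted as sets. For a positive integer $m$, $\mathrm{rad}(m)$ denotes the product of the distinct prime factors of $m$ (so $\mathrm{rad}(1)=1$). *)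

(* Defs.v *)
From mathcomp Require Export all_boot all_algebra.
From mathcomp Require Export finmap boolp classical_sets functions cardinality.

Set Implicit Arguments.
Unset Strict Implicit.
Unset Printing Implicit Defensive.

Import GRing.Theory.

Local Open Scope classical_set_scope.
Local Open Scope nat_scope.

Definition numerical_semigroup (S : set nat) : Prop :=
  [/\ S 0, (forall x y, S x -> S y -> S (x + y)) & finite_set (~` S)].

Definition genus (S : set nat) : nat := #|` fset_set (~` S)|%fset.

Definition generated2 (a b : nat) : set nat :=
  [set n | exists x y, n = x * a + y * b].

(* For every S of genus g >= 1, "of the form <a, b>" already excludes a single
   generator: <a> is cofinite only for a = 1, and then has genus 0. *)
Definition semigroups2 (g : nat) : set (set nat) :=
  [set S | [/\ numerical_semigroup S, genus S = g &
               exists a b, S = generated2 a b]].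

(* n(g, 2).  [fset_set] sends infinite sets to the empty one; this default is
   not used, as there are finitely many numerical semigroups of each genus. *)
Definition nsg2 (g : nat) : nat := #|` fset_set (semigroups2 g)|%fset.

Definition rad (m : nat) : nat := \prod_(q <- primes m) q.

(* Every factor is positive: for even k / gcd(i, k) it is 2^j - 1 with j >= 1. *)
Definition modulusM (k : nat) : nat :=
  rad (absz (\prod_(1 <= i < k.+1)
    ((2 : int) ^+ (i %/ gcdn i k) - (-1) ^+ (k %/ gcdn i k)))%R).

(* Main.v *)
Require Import Defs.
From mathcomp Require Import zify.

(** Two generators [a], [b] give a numerical semigroup exactly when they are
    coprime, and Sylvester's formula then makes its genus [(a - 1)(b - 1) / 2].
    So the semigroups of genus [p ^ k] come from the factorisations of
    [2 p ^ k], that is, from the pairs [a = p ^ i + 1], [b = 2 p ^ (k - i) + 1]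
    with [i <= k]; for odd [p] distinct [i] give distinct semigroups
    ([power_semigroup_inj]), hence [n (p ^ k, 2)] counts the [i <= k] for which
    [a] and [b] are coprime ([nsg2_prime_power]).

    A prime [q] dividing both [a] and [b] satisfies [p ^ i = -1] and
    [2 p ^ (k - i) = -1], hence [2 p ^ k = 1], modulo [q].  With
    [d = gcd (i, k)], both [(p ^ i) ^ (k / d)] and [(p ^ k) ^ (i / d)] are
    [p ^ (i k / d)], so [2 ^ (i / d) = (-1) ^ (k / d)] modulo [q]
    ([common_prime_dvd_factor]).  All primes that can obstruct coprimality
    therefore divide [M(k)], and whether such a [q] divides [a] and [b] is seen
    on the class of [p] modulo [q]. *)

Set Implicit Arguments.
Unset Strict Implicit.
Unset Printing Implicit Defensive.

Import GRing.Theory.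

Local Open Scope classical_set_scope.
Local Open Scope nat_scope.

(** * Counting sets by duplicate-free sequences *)

Lemma card_fset_set_seq (T : choiceType) (A : set T) (s : seq T) :
  uniq s -> (forall x, A x <-> x \in s) -> #|` fset_set A|%fset = size s.
Proof.
move=> us As; have -> : A = [set` [fset x in s]%fset].
  by apply/seteqP; split=> x /=; rewrite inE => /As.
by rewrite set_fsetK card_fseq undup_id.
Qed.

(** * Sylvester's genus formula *)

Lemma generated2C a b : generated2 a b = generated2 b a.
Proof.
by apply/seteqP; split=> n [x [y ->]]; exists y, x; rewrite addnC.
Qed.

(** If [n] and [m] both had representations, adding them would write [a * b]
    with positive coefficients; by coprimality [b] divides the coefficient of
    [a] and conversely, so the value would be at least [2 * a * b]. *)
Lemma generated2_not_both a b n m : 0 < a -> 0 < b -> coprime a b ->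
  generated2 a b n -> generated2 a b m -> n + m + a + b <> a * b.
Proof.
move=> a0 b0 co [x [y ->]] [x' [y' ->]] E.
have {}E : (x + x').+1 * a + (y + y').+1 * b = a * b by rewrite -E; nia.
have bx : b %| (x + x').+1.
  rewrite -(Gauss_dvdl _ (_ : coprime b a)) 1?coprime_sym //.
  by rewrite -(dvdn_addl (n := (y + y').+1 * b)) ?dvdn_mull // E dvdn_mull.
have ay : a %| (y + y').+1.
  rewrite -(Gauss_dvdl _ co).
  by rewrite -(dvdn_addr (m := (x + x').+1 * a)) ?dvdn_mull // E dvdn_mulr.
move: (dvdn_leq (ltn0Sn _) bx) (dvdn_leq (ltn0Sn _) ay) => lx ly; nia.
Qed.

(** Among the multiples of [a] below [a * b], one, [x * a], is congruent to [n]
    modulo [b].  When [n] is a gap it exceeds [n], so [x * a = n + t * b] with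
    [t > 0], and [m = (b - 1 - x) * a + (t - 1) * b] works. *)
Lemma generated2_gap_mirror a b n : 0 < a -> 0 < b -> coprime a b ->
  ~ generated2 a b n -> exists2 m, generated2 a b m & n + m + a + b = a * b.
Proof.
move=> a0 b0 co nS; set z := chinese a b 0 n %% (a * b).
have zlt : z < a * b by rewrite ltn_mod muln_gt0 a0.
have /dvdnP[x zE] : a %| z.
  by rewrite /dvdn modn_dvdm ?dvdn_mulr // chinese_modl // mod0n.
have zn : z = n %[mod b] by rewrite modn_dvdm ?dvdn_mull // chinese_modr.
have [le_zn|lt_nz] := leqP z n.
  case: nS; have /dvdnP[y yE] : b %| n - z by rewrite -eqn_mod_dvd // zn.
  by exists x, y; rewrite -zE -yE subnKC.
have /dvdnP[t tE] : b %| z - n by rewrite -eqn_mod_dvd ?zn // ltnW.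
have xb : x < b by rewrite -(ltn_pmul2r a0) -zE [b * a]mulnC.
have t0 : 0 < t by rewrite lt0n; apply/eqP => t0; move: tE; rewrite t0; lia.
exists ((b - x.+1) * a + t.-1 * b); first by exists (b - x.+1), t.-1.
have -> : (b - x.+1) * a = b * a - x * a - a by rewrite mulnBl mulSn; lia.
have -> : t.-1 * b = t * b - b by rewrite -subn1 mulnBl mul1n.
have : x.+1 * a <= b * a by rewrite leq_mul2r xb orbT.
have : 1 * b <= t * b by rewrite leq_mul2r t0 orbT.
rewrite mul1n mulSn; lia.
Qed.

Lemma generated2_large a b n : 0 < a -> 0 < b -> coprime a b ->
  a.-1 * b.-1 <= n -> generated2 a b n.
Proof.
move=> a0 b0 co le_n; apply: contrapT => /(generated2_gap_mirror a0 b0 co)[m _].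
by nia.
Qed.

Lemma generated2_mirror a b n : 0 < a -> 0 < b -> coprime a b ->
  n < a.-1 * b.-1 ->
  `[< generated2 a b (a.-1 * b.-1 - n.+1) >] = ~~ `[< generated2 a b n >].
Proof.
move=> a0 b0 co lt_n; apply/idP/idP => [/asboolP Sm|].
  apply/negP => /asboolP Sn; apply: (generated2_not_both a0 b0 co Sn Sm).
  by nia.
move=> /asboolPn /(generated2_gap_mirror a0 b0 co)[m Sm E]; apply/asboolP.
suff -> : a.-1 * b.-1 - n.+1 = m by [].
by nia.
Qed.

(** The reflection [n |-> (a - 1)(b - 1) - 1 - n] exchanges gaps and elements
    below [(a - 1)(b - 1)], so exactly half of these numbers are gaps. *)
Lemma genus_generated2 a b : 0 < a -> 0 < b -> coprime a b ->
  (genus (generated2 a b)).*2 = a.-1 * b.-1.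
Proof.
move=> a0 b0 co; set c := a.-1 * b.-1; pose P n := ~~ `[< generated2 a b n >].
have -> : genus (generated2 a b) = count P (index_iota 0 c).
  rewrite -size_filter; apply: card_fset_set_seq => [|n].
    by rewrite filter_uniq ?iota_uniq.
  rewrite mem_filter mem_index_iota /=; split=> [nS|/andP[/asboolPn //]].
  apply/andP; split; first exact/asboolPn.
  by rewrite ltnNge; apply/negP => /(generated2_large a0 b0 co)/nS.
rewrite -addnn -sum1_count big_mkcond /=.
rewrite {1}big_nat_rev -big_split /= -[RHS]muln1 -[X in X * 1]subn0.
rewrite -sum_nat_const_nat; apply: eq_big_nat => n /andP[_ lt_n].
by rewrite /P add0n generated2_mirror //; case: `[< _ >].
Qed.

Lemma numerical_semigroup_generated2 a b : 0 < a -> 0 < b -> coprime a b ->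
  numerical_semigroup (generated2 a b).
Proof.
move=> a0 b0 co; split.
- by exists 0, 0.
- move=> _ _ [x [y ->]] [x' [y' ->]]; exists (x + x'), (y + y').
  by rewrite !mulnDl; lia.
- apply: (sub_finite_set _ (finite_II (a.-1 * b.-1))) => n nS /=.
  by rewrite ltnNge; apply/negP => /(generated2_large a0 b0 co)/nS.
Qed.

(** A common divisor of [a] and [b] divides every element, among them two
    consecutive integers beyond all gaps. *)
Lemma numerical_semigroup_coprime a b :
  numerical_semigroup (generated2 a b) -> coprime a b.
Proof.
case=> _ _ fin; set d := gcdn a b.
have dS n : generated2 a b n -> d %| n.
  by case=> x [y ->]; rewrite dvdn_add // dvdn_mull ?dvdn_gcdl ?dvdn_gcdr.
have bound : forall n, ~ generated2 a b n ->
    n <= \max_(m <- fset_set (~` generated2 a b)) m.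
  by move=> n nS; apply: leq_bigmax_seq => //; rewrite in_fset_set // inE.
set N := \max_(m <- _) m in bound.
have S n : N < n -> generated2 a b n.
  by move=> ltn; apply: contrapT => /bound; rewrite leqNgt ltn.
have d1 : d %| N.+1 by apply/dS/S.
have : d %| N.+1 + 1 by rewrite addn1; apply/dS/S.
by rewrite dvdn_addr // dvdn1.
Qed.

(** The smaller generator is the least positive element. *)
Lemma generated2_min a b a' b' :
  0 < a -> 0 < b -> 0 < a' -> 0 < b' ->
  generated2 a b = generated2 a' b' -> minn a b = minn a' b'.
Proof.
have lower x y u v : 0 < u -> 0 < v ->
    generated2 x y = generated2 u v -> minn x y <= minn u v.
  move=> u0 v0 E.
  have small n : 0 < n -> generated2 x y n -> minn x y <= n.
    move=> n0 [i [j En]]; rewrite {}En in n0 *; rewrite geq_min.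
    by case: i n0 => [|i] n0; [case: j n0 => [|j] n0|]; nia.
  rewrite leq_min !small // E; first by exists 0, 1; rewrite mul0n mul1n.
  by exists 1, 0; rewrite mul0n mul1n addn0.
by move=> a0 b0 a0' b0' E; apply/eqP; rewrite eqn_leq !lower.
Qed.

(** * The semigroups of genus a prime power *)

Definition power_pair_coprime (p k i : nat) : bool :=
  coprime (p ^ i).+1 (2 * p ^ (k - i)).+1.

Definition power_semigroup (p k i : nat) : set nat :=
  generated2 (p ^ i).+1 (2 * p ^ (k - i)).+1.

(** Comparing least positive elements: powers of [p] determine their exponents,
    and [p ^ i = 2 * p ^ (k - j)] is impossible by parity. *)
Lemma power_semigroup_inj p k i j : odd p -> 1 < p -> i <= k -> j <= k ->
  power_semigroup p k i = power_semigroup p k j -> i = j.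
Proof.
move=> op p1 ik jk /generated2_min -/(_ isT isT isT isT).
rewrite !minnSS => - [E].
have inj m n : p ^ m = p ^ n -> m = n by apply: expnI.
have par m n : p ^ m <> 2 * p ^ n.
  by move/(congr1 odd); rewrite mul2n odd_double oddX op orbT.
have dbl m n : 2 * p ^ (k - m) = 2 * p ^ (k - n) -> k - m = k - n.
  by move=> /eqP; rewrite eqn_pmul2l // => /eqP /inj.
move: E; rewrite /minn; case: ifP => _; case: ifP => _.
- exact: inj.
- by move/par.
- by move/esym/par.
- by move/dbl; lia.
Qed.

Lemma factor_double_prime_power p k d e : prime p -> d * e = 2 * p ^ k ->
  exists2 i, i <= k &
    (d = p ^ i /\ e = 2 * p ^ (k - i)) \/ (e = p ^ i /\ d = 2 * p ^ (k - i)).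
Proof.
move=> pp; have half u v : 2 %| v -> u * v = 2 * p ^ k ->
    exists2 i, i <= k & u = p ^ i /\ v = 2 * p ^ (k - i).
  case/dvdnP=> w -> E; have {}E : u * w = p ^ k by lia.
  have /(dvdn_pfactor _ _ pp)[i ik uE] : u %| p ^ k by rewrite -E dvdn_mulr.
  exists i => //; split=> //; rewrite mulnC; congr (_ * _).
  apply/eqP; rewrite -(eqn_pmul2l (_ : 0 < p ^ i)) ?expn_gt0 ?prime_gt0 //.
  by rewrite -expnD subnKC // -uE E.
move=> E; have : 2 %| d * e by rewrite E dvdn_mulr.
rewrite Euclid_dvdM // => /orP[d2|e2].
  by rewrite mulnC in E; case: (half _ _ d2 E) => i ik H; exists i; auto.
by case: (half _ _ e2 E) => i ik H; exists i; auto.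
Qed.

Lemma semigroups2_prime_power p k (S : set nat) : prime p ->
  semigroups2 (p ^ k) S <->
  exists2 i, (i <= k) && power_pair_coprime p k i & S = power_semigroup p k i.
Proof.
move=> pp; split=> [[nsS gS [a [b SE]]]|[i /andP[ik co] ->]]; last first.
  split; [exact: numerical_semigroup_generated2| |by do 2!eexists].
  apply: double_inj; rewrite genus_generated2 //= mulnCA -expnD subnKC //.
  by rewrite mul2n.
rewrite {}SE in nsS gS *; have co := numerical_semigroup_coprime nsS.
have g0 : 0 < p ^ k by rewrite expn_gt0 prime_gt0.
(* A zero generator forces the other one to be 1, and the genus to be 0. *)
have full u : genus (generated2 u 1) <> p ^ k.
  suff -> : genus (generated2 u 1) = 0 by lia.
  apply: (@card_fset_set_seq _ _ [::]) => // n; split=> // nS; case: nS.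
  by exists 0, n; rewrite mul0n muln1.
case: a => [|a] in nsS gS co *.
  by move: co gS; rewrite /coprime gcd0n => /eqP -> /full.
case: b => [|b] in nsS gS co *.
  move: co gS; rewrite /coprime gcdn0 => /eqP ->.
  by rewrite generated2C => /full.
have := genus_generated2 (ltn0Sn a) (ltn0Sn b) co.
rewrite gS -mul2n => /esym /(factor_double_prime_power pp)[i ik /=].
case=> -[aE bE]; exists i => //; rewrite ?ik /power_pair_coprime -?aE -?bE //.
- by rewrite /power_semigroup -aE -bE.
- by rewrite coprime_sym.
- by rewrite generated2C /power_semigroup -aE -bE.
Qed.

Lemma nsg2_prime_power p k : prime p -> odd p ->
  nsg2 (p ^ k) = count (power_pair_coprime p k) (iota 0 k.+1).
Proof.
move=> pp op.
rewrite -size_filter -(size_map (power_semigroup p k)).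
apply: card_fset_set_seq => [|S].
  rewrite map_inj_in_uniq ?filter_uniq ?iota_uniq // => i j.
  rewrite !mem_filter !mem_iota !add0n !ltnS => /andP[_ ik] /andP[_ jk].
  exact: power_semigroup_inj (prime_gt1 pp) ik jk.
rewrite semigroups2_prime_power //; split=> [[i /andP[ik co] ->]|].
  by apply: map_f; rewrite mem_filter co mem_iota add0n ltnS ik.
case/mapP=> i; rewrite mem_filter mem_iota add0n ltnS /= => /andP[co ik] ->.
by exists i => //; rewrite ik co.
Qed.

(** * Primes obstructing coprimality *)

Lemma dvdn_rad q m : prime q -> 0 < m -> q %| m -> q %| rad m.
Proof.
move=> pq m0 qm; have qin : q \in primes m by rewrite mem_primes pq m0.
by rewrite /rad (big_rem q qin) /= dvdn_mulr.
Qed.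

Definition modulus_factor (k i : nat) : int :=
  ((2 : int) ^+ (i %/ gcdn i k) - (-1) ^+ (k %/ gcdn i k))%R.

Lemma modulus_factor_neq0 k i : 0 < i -> modulus_factor k i != 0%R.
Proof.
move=> i0; rewrite subr_eq0.
have : 0 < i %/ gcdn i k.
  by rewrite divn_gt0 ?gcdn_gt0 ?i0 // dvdn_leq ?dvdn_gcdl.
case: (i %/ gcdn i k) => // j _; rewrite exprS -signr_odd.
apply/eqP; case: (odd _) => /=; lia.
Qed.

Lemma prime_dvd_modulusM q k i : prime q -> 0 < i <= k ->
  (q %| modulus_factor k i)%Z -> q %| modulusM k.
Proof.
move=> pq /andP[i0 ik] qi; apply: dvdn_rad => //.
  rewrite absz_gt0 big_seq prodf_seq_neq0; apply/allP => j.
  rewrite mem_index_iota => /andP[j0 _]; apply/implyP => _.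
  exact: modulus_factor_neq0.
have iin : i \in index_iota 1 k.+1 by rewrite mem_index_iota i0.
by rewrite (big_rem i iin) /= abszM dvdn_mulr.
Qed.

(** In the field with [q] elements, [p ^ i = -1] and
    [2 * p ^ (k - i) = -1] give [p ^ k = 1 / 2].  Computing
    [p ^ (i * k / gcd i k)] from either power yields
    [(-1) ^ (k / gcd i k) = (1 / 2) ^ (i / gcd i k)]. *)
Lemma common_prime_dvd_factor p k i q : prime q -> i <= k ->
  q %| (p ^ i).+1 -> q %| (2 * p ^ (k - i)).+1 ->
  (q %| modulus_factor k i)%Z.
Proof.
move=> pq ik; have chq := pchar_Fp pq.
rewrite (dvdz_pcharf chq) !(dvdn_pcharf chq).
rewrite -(natr1 (p ^ i)) -(natr1 (2 * _)) natrM !natrX !addr_eq0 => /eqP pi /eqP pki.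
have pk : (2%:R * p%:R ^+ k = 1 :> 'F_q)%R.
  by rewrite -(subnKC ik) exprD mulrCA pki pi mulrNN mulr1.
have Eexp : k * (i %/ gcdn i k) = i * (k %/ gcdn i k).
  by rewrite muln_divA ?dvdn_gcdl // mulnC -muln_divA ?dvdn_gcdr.
have sgn2 n : ((-1) ^+ n * (-1) ^+ n = 1 :> 'F_q)%R.
  by rewrite -exprMn mulrNN mulr1 expr1n.
rewrite rmorphB !rmorphXn /= rmorphN rmorph1 subr_eq0; apply/eqP.
transitivity ((2%:R * p%:R ^+ k) ^+ (i %/ gcdn i k)
              * (-1) ^+ (k %/ gcdn i k) : 'F_q)%R.
  by rewrite exprMn -exprM Eexp exprM pi -mulrA sgn2 mulr1.
by rewrite pk expr1n mul1r.
Qed.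

Lemma modn_dvd_eq m d x y : d %| m -> x = y %[mod m] -> x = y %[mod d].
Proof. by move=> dm E; rewrite -(modn_dvdm x dm) E modn_dvdm. Qed.

Lemma power_pair_coprime_transfer p p' k i : i <= k ->
  p = p' %[mod modulusM k] ->
  power_pair_coprime p' k i -> power_pair_coprime p k i.
Proof.
move=> ik E co; apply/negPn/negP => nco.
pose q := pdiv (gcdn (p ^ i).+1 (2 * p ^ (k - i)).+1).
have pq : prime q.
  by apply: pdiv_prime; rewrite ltn_neqAle eq_sym nco gcdn_gt0.
have := pdiv_dvd (gcdn (p ^ i).+1 (2 * p ^ (k - i)).+1).
rewrite -/q dvdn_gcd => /andP[qa qb].
(* For i = 0 the first generator is 2, whereas the second one is odd. *)
have i0 : 0 < i.
  case: i ik co nco @q pq qa qb => // ik co nco q pq qa qb.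
  have q2 : q = 2 by apply/eqP; rewrite -(dvdn_prime2 pq).
  by move: qb; rewrite q2 -(addn1 (2 * _)) dvdn_addr ?dvdn_mulr.
have Eq : p = p' %[mod q].
  apply: modn_dvd_eq E; apply: (@prime_dvd_modulusM _ _ i) => //.
    by rewrite i0.
  exact: common_prime_dvd_factor qa qb.
have EX n : p ^ n = p' ^ n %[mod q] by rewrite -modnXm Eq modnXm.
have : q %| gcdn (p' ^ i).+1 (2 * p' ^ (k - i)).+1.
  rewrite dvdn_gcd /dvdn -(addn1 (p' ^ i)) -(addn1 (2 * _)) -modnDml -EX modnDml addn1 [X in X && _]qa.
  by rewrite -modnDml -modnMmr -EX modnMmr modnDml addn1 [_ == _]qb.
by rewrite (eqP co) dvdn1 => /eqP q1; rewrite q1 in pq.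
Qed.

Theorem theorem4p1 (k : nat) (hk : 1 <= k) (p p' : nat)
    (hp : prime p) (hpodd : odd p) (hp' : prime p') (hpodd' : odd p')
    (hpp' : p = p' %[mod modulusM k]) :
  nsg2 (p ^ k) = nsg2 (p' ^ k).
Proof.
rewrite !nsg2_prime_power //; apply: eq_in_count => i.
rewrite mem_iota add0n ltnS => /= ik.
by apply/idP/idP; apply: power_pair_coprime_transfer.
Qed.
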